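(* Let $d>0$, $\lambda>0$, $A\in\mathbb{R}^{m\times n}$, $y\in\mathbb{R}^m$, and let $\alpha>0$ satisfy $\alpha\gamma>2C^2$ and $\alpha\ge C$, where $C>0$ is a Lipschitz constant of $\nabla g$ and $\gamma>0$ is a strong convexity coefficient of $x\mapsto\mathcal{L}(x,z;\mu)$ (with $g$ and $\mathcal{L}$ as defined in the context). Let $(x_t,z_t,\mu_t)_{t\ge1}$ be the sequence generated by the MADMM algorithm for $\mathcal{F}$. Then MADMM converges to the set $Z$ of stationary points of the problem $$\min_{x,z}\ \frac12\|y-Ax\|_2^2-\frac{\lambda}{2}\|x\|_2^2+\lambda d\|z\|_1\quad\text{s.t. } z=x,\ x\in[-d,d]^n,$$ that is, $\lim_{t\to\infty}\min_{z\in Z}\|x_t-z\|_2=0$.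
   Context: Let $g(x)=\frac12\|y-Ax\|_2^2-\frac{\lambda}{2}\|x\|_2^2$ and $h(z)=\lambda d\|z\|_1$. The augmented Lagrangian is $$\mathcal{L}(x,z;\mu)=g(x)+h(z)+\mu^T(x-z)+\frac{\alpha}{2}\|x-z\|_2^2 .$$ MADMM for $\mathcal{F}(x)=\frac12\|y-Ax\|_2^2+\lambda d\|x\|_1-\frac{\lambda}{2}\|x\|_2^2$ on $[-d,d]^n$: initialize $z_0=\mu_0=0\in\mathbb{R}^n$ and for $t=1,2,\dots$ set $$x_t=\operatorname*{argmin}_{x\in[-d,d]^n}\mathcal{L}(x,z_{t-1};\mu_{t-1}),\qquad z_t=\operatorname*{argmin}_{z\in[-d,d]^n}\mathcal{L}(x_t,z;\mu_{t-1}),\qquad \mu_t=\mu_{t-1}+\alpha(x_t-z_t).$$ Stationary points of the constrained problem are, in terms of the common value $x=z$, the points $x\in[-d,d]^n$ such that $0\in\nabla g(x)+\partial h(x)+N_{[-d,d]^n}(x)$, where $\partial h$ is the convex subdifferential and $N_{[-d,d]^n}(x)$ the normal cone of the box at $x$. *)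

(* Defs.v *)
From HB Require Import structures.
From mathcomp Require Import all_boot all_order all_algebra.
From mathcomp Require Import all_classical all_reals all_analysis.

Set Implicit Arguments.
Unset Strict Implicit.
Unset Printing Implicit Defensive.

Import Order.TTheory GRing.Theory Num.Theory.
Import numFieldNormedType.Exports.

Local Open Scope classical_set_scope.
Local Open Scope ring_scope.

Section Euclidean.
Variables (R : realType) (n : nat).
Implicit Types (u v x : 'cV[R]_n) (f : 'cV[R]_n -> R) (K : set 'cV[R]_n).

Definition dotp u v : R := \sum_i u i 0 * v i 0.

(* The library norm `|u| on matrices is the sup norm, hence these two. *)
Definition norm2 u : R := Num.sqrt (dotp u u).

Definition norm1 u : R := \sum_i `|u i 0|.

Definition grad f x : 'cV[R]_n := \col_i 'D_(delta_mx i 0) f x.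

Definition lipschitz2 (C : R) (F : 'cV[R]_n -> 'cV[R]_n) : Prop :=
  forall u v, norm2 (F u - F v) <= C * norm2 (u - v).

(* Normalized so that a twice differentiable f is gamma-strongly convex iff
   its Hessian is everywhere at least gamma times the identity. *)
Definition strongly_convex (gamma : R) f : Prop :=
  forall u v (t : R), 0 <= t <= 1 ->
    f (t *: u + (1 - t) *: v) <=
      t * f u + (1 - t) * f v
      - gamma / 2 * (t * (1 - t)) * norm2 (u - v) ^+ 2.

Definition subdiff f x : set 'cV[R]_n :=
  [set s | forall u, f x + dotp s (u - x) <= f u].

Definition normal_cone K x : set 'cV[R]_n :=
  [set v | K x /\ forall u, K u -> dotp v (u - x) <= 0].

Definition is_argmin K f x : Prop := K x /\ forall u, K u -> f x <= f u.

Definition box (d : R) : set 'cV[R]_n := [set x | forall i, - d <= x i 0 <= d].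

End Euclidean.

Section MADMM.
Variables (R : realType) (m n : nat).
Variables (A : 'M[R]_(m, n)) (y : 'cV[R]_m) (lambda d : R).
Implicit Types (u v w : 'cV[R]_n).

Definition obj_g u : R :=
  1 / 2 * norm2 (y - A *m u) ^+ 2 - lambda / 2 * norm2 u ^+ 2.

Definition obj_h w : R := lambda * d * norm1 w.

Definition aug_lagrangian (alpha : R) u w v : R :=
  obj_g u + obj_h w + dotp v (u - w) + alpha / 2 * norm2 (u - w) ^+ 2.

(* x 0 is not constrained: the algorithm starts from z 0 and mu 0 only. *)
Definition is_MADMM (alpha : R) (x z mu : nat -> 'cV[R]_n) : Prop :=
  [/\ z 0%N = 0, mu 0%N = 0 &
      forall t : nat,
        [/\ is_argmin (box d)
              (fun u => aug_lagrangian alpha u (z t) (mu t)) (x t.+1),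
            is_argmin (box d)
              (fun w => aug_lagrangian alpha (x t.+1) w (mu t)) (z t.+1) &
            mu t.+1 = mu t + alpha *: (x t.+1 - z t.+1)]].

(* A pair (u, u) feasible for the constraint z = x is identified with u. *)
Definition stationary : set 'cV[R]_n :=
  [set u | box d u /\
     exists s v, [/\ subdiff obj_h u s, normal_cone (box d) u v &
                     grad obj_g u + s + v = 0]].

End MADMM.

(* Main.v *)
Require Import Defs.
From HB Require Import structures.
From mathcomp Require Import all_boot all_order all_algebra.
From mathcomp Require Import all_classical all_reals all_analysis.
From mathcomp Require Import ring lra.

Set Implicit Arguments.
Unset Strict Implicit.
Unset Printing Implicit Defensive.

Import Order.TTheory GRing.Theory Num.Theory.
Import numFieldNormedType.Exports.

Local Open Scope classical_set_scope.
Local Open Scope ring_scope.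

(** Why the iterates approach the stationary set.

    Divide g, h and mu by alpha, so that the penalty parameter becomes 1. Let Q
    be the Hessian of g and v_t the multiplier of the box constraint in the
    x-step, and put a_t = x_t - z_t (the increment of mu),
    D_t = z_t - z_(t-1) and p_t = x_t - z_(t-1) = a_t + D_t.

    The z-step is coordinatewise. Starting from mu = 0 it keeps every entry of
    mu in [-lambda d, lambda d] and makes mu_t a subgradient of h at z_t on the
    whole space: the box constraint on z never binds ([mu_dual]). Hence
    (x_t, mu_t) satisfies the optimality system of the problem up to a_t and
    D_t. These two agree in sign in every coordinate, so it suffices that p_t
    tends to 0.

    The update of mu raises the augmented Lagrangian by |a_t|^2. As the
    nonsmooth block is minimized last and the box constrains x, this increase
    is not controlled by x_t - x_(t-1), and the augmented Lagrangian need not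
    decrease. A decreasing quantity is the energy
      g(x_t) + h(z_t) + <mu_t + 2 v_t, x_t - z_t>
        + <p_t, H p_t> + |D_t|^2,    where H = Q + 1/2,
    in which the weight of p_t depends on the curvature of g and the term in
    v_t pays for the coordinates in which x sits on a face of the box. Its
    decrease in one step is, up to terms of the right sign coming from the
    monotonicity of the subdifferential of h and of the normal cone,
      3 <u, H u> + (1/6) <e, (5 - 2 H) e> + (1/12) <X, H (5 - 2 H) X>
        + (1/6) |w|^2
    with X and w the increments of x and v, e = w + H X and
    u = p - (2/3) (X - H X) + (2/3) w ([energy_descent]). This is positive
    definite when every eigenvalue q of Q lies in (-1/2, 1), and that is what
    2 C^2 < alpha gamma ensures: after the normalization |q| <= C and
    gamma <= 1 + q, so 2 q^2 < 1 + q ([hess_bounds]). The energy is bounded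
    below because x, z and mu are bounded, so p_t tends to 0 ([step_cvg0]).

    The pairs (x, mu) solving the optimality system exactly form a compact set
    whose first projection is the stationary set ([stationaryE]). A sequence in
    a compact set whose residuals tend to 0 enters every neighbourhood of the
    zero set of the residuals ([compact_eventually]), which is the claim. *)

(** * Euclidean inner product *)

Local Ltac vector_field := apply/matrixP => ? ?; rewrite !mxE; field.

Section DotProduct.
Variables (R : realType) (n : nat).
Implicit Types (u v w : 'cV[R]_n) (Q : 'M[R]_n).

Lemma dotpC u v : dotp u v = dotp v u.
Proof. by apply: eq_bigr => i _; rewrite mulrC. Qed.

Lemma dotpDl u v w : dotp (u + v) w = dotp u w + dotp v w.
Proof. by rewrite -big_split; apply: eq_bigr => i _; rewrite mxE mulrDl. Qed.

Lemma dotpZl c u v : dotp (c *: u) v = c * dotp u v.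
Proof. by rewrite mulr_sumr; apply: eq_bigr => i _; rewrite mxE mulrA. Qed.

Lemma dotpNl u v : dotp (- u) v = - dotp u v.
Proof. by rewrite -scaleN1r dotpZl mulN1r. Qed.

Lemma dotpDr u v w : dotp w (u + v) = dotp w u + dotp w v.
Proof. by rewrite !(dotpC w) dotpDl. Qed.

Lemma dotpZr c u v : dotp v (c *: u) = c * dotp v u.
Proof. by rewrite !(dotpC v) dotpZl. Qed.

Lemma dotpNr u v : dotp v (- u) = - dotp v u.
Proof. by rewrite !(dotpC v) dotpNl. Qed.

Definition dotpE := (dotpDl, dotpDr, dotpNl, dotpNr, dotpZl, dotpZr).

Lemma dotp0l u : dotp 0 u = 0.
Proof. by rewrite -(scale0r u) dotpZl mul0r. Qed.

Lemma dotp_ge0 u : 0 <= dotp u u.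
Proof. by apply: sumr_ge0 => i _; exact: sqr_ge0. Qed.

Lemma norm2_ge0 u : 0 <= norm2 u.
Proof. exact: sqrtr_ge0. Qed.

Lemma norm2_sqr u : norm2 u ^+ 2 = dotp u u.
Proof. by rewrite sqr_sqrtr ?dotp_ge0. Qed.

End DotProduct.

Lemma dotp_mulmx (R : realType) m n (B : 'M[R]_(m, n)) (u : 'cV[R]_m)
    (v : 'cV[R]_n) : dotp u (B *m v) = dotp (B^T *m u) v.
Proof.
have dotpM k (a b : 'cV[R]_k) : dotp a b = (a^T *m b) 0 0.
  by rewrite mxE; apply: eq_bigr => i _; rewrite mxE.
by rewrite !dotpM trmx_mul trmxK mulmxA.
Qed.

(** * The energy and its decrease *)

Section Energy.
Variables (R : realType) (n : nat) (Q : 'M[R]_n) (b : 'cV[R]_n).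
Hypothesis Qsym : Q^T = Q.
Implicit Types (x z v mu X w p y u : 'cV[R]_n).

Definition quad x : R := 1 / 2 * dotp x (Q *m x) + dotp b x.

(** The normalized energy: [mu] and [hz] are the multiplier and the value of h
    divided by alpha, and [v] is the box multiplier of the x-step. *)
Definition energy x zprev z mu v (hz : R) : R :=
  quad x + hz + dotp (mu + 2 *: v) (x - z)
  + (1 / 2 * dotp (x - zprev) (x - zprev) + dotp (x - zprev) (Q *m (x - zprev)))
  + dotp (z - zprev) (z - zprev).

(** The operator H. While z stays 0 and x inside the box, a step multiplies x by
    Q (1 + Q)^-1; as 1 + Q is positive, this contracts exactly when H is positive. *)
Definition hess u := Q *m u + (1 / 2) *: u.

(** The first square is completed in p. In the remainder the coefficient of |w|^2
    is then split into 1/6 and a multiple of 5 - 2 H, after which the rest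
    factors through 5 - 2 H. *)
Definition dissipation X w p : R :=
  let u := p - (2 / 3) *: (X - hess X) + (2 / 3) *: w in
  let y := w + hess X in
  3 * dotp u (hess u) + 1 / 6 * (5 * dotp y y - 2 * dotp y (hess y))
  + 1 / 12 * (5 * dotp X (hess X) - 2 * dotp (hess X) (hess X))
  + 1 / 6 * dotp w w.

Let Qdotp u y : dotp u (Q *m y) = dotp (Q *m u) y.
Proof. by rewrite dotp_mulmx Qsym. Qed.

Lemma quadB x X :
  quad x - quad (x - X) = dotp (Q *m x + b) X - 1 / 2 * dotp X (Q *m X).
Proof.
have E1 := Qdotp X x; have E2 := dotpC (Q *m X) x; have E3 := dotpC X (Q *m x).
by rewrite /quad !(mulmxDr, mulmxN, dotpE); lra.
Qed.

(** The algebraic core. Every vector of two consecutive steps is a combination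
    of p, D, v, mu of the later step and of the increments X and w of x and v:
    the earlier increment of z is p + Q X + w, by subtracting the two optimality
    conditions in x. The identity is then one between coordinates, once the
    symmetry of Q has been used to move Q from X to the other argument. *)
Lemma energy_identity p D X v w mu :
  let S := Q *m X in let a := p - D in let a0 := p - X in
  let D0 := p + S + w in let p0 := a0 + D0 in
  dotp (- (v + mu + D)) X - 1 / 2 * dotp X S
    + dotp (mu + 2 *: v) a - dotp (mu - a + 2 *: (v - w)) a0
    + (1 / 2 * dotp p p + dotp p (Q *m p)) + dotp D D
    - (1 / 2 * dotp p0 p0 + dotp p0 (Q *m p0)) - dotp D0 D0
  = - dissipation X w p - dotp mu D - dotp a D - 2 * dotp v D + dotp (v - w) X.
Proof.
move=> S a a0 D0 p0.
have Ep0 : Q *m p0 = 2 *: (Q *m p) - S + Q *m S + Q *m w.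
  rewrite /p0 /a0 /D0 !(mulmxDr, mulmxN) -/S.
  by apply/matrixP=> i j; rewrite !mxE; ring.
have Ehess u : hess u = Q *m u + (1 / 2) *: u by [].
have := Qdotp X p; have := Qdotp X S; have := Qdotp X w; rewrite -/S.
rewrite Ep0 /dissipation !Ehess /p0 /D0 /a0 /a {p0 D0 a0 a Ep0}.
rewrite !(mulmxDr, mulmxN, =^~ scalemxAr) -/S.
move: S (Q *m p) (Q *m S) (Q *m w) => S Qp QS Qw Sw SS Sp.
set L := LHS; set r := RHS.
suff : L = r + (dotp X Qp - dotp S p) + 1 / 6 * (dotp X QS - dotp S S)
     + 1 / 6 * (dotp X Qw - dotp S w).
  by rewrite Sw SS Sp !subrr mulr0 !addr0.
rewrite {}/L {}/r /dotp !mulr_sumr -!sumrN -!big_split /=.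
rewrite !mulr_sumr -!big_split /= -!sumrN -!big_split /=.
by apply: eq_bigr => i _; rewrite !mxE; field.
Qed.

(** The first hypotheses are the optimality condition in x at two consecutive
    steps and the multiplier update. The inequalities say that mu1 is a
    subgradient of h at z1, that the subgradients are monotone, that v1 and the
    increment of z agree in sign, and that v0 is normal to the box at x0. *)
Lemma energy_descent x0 x1 zz z0 z1 mu0 mu1 v0 v1 (h0 h1 : R) :
    Q *m x0 + b + v0 + mu0 + (z0 - zz) = 0 ->
    Q *m x1 + b + v1 + mu1 + (z1 - z0) = 0 ->
    mu1 = mu0 + (x1 - z1) ->
    h1 + dotp mu1 (z0 - z1) <= h0 ->
    0 <= dotp (mu1 - mu0) (z1 - z0) ->
    0 <= dotp v1 (z1 - z0) ->
    dotp v0 (x1 - x0) <= 0 ->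
  energy x1 z0 z1 mu1 v1 h1 <= energy x0 zz z0 mu0 v0 h0
    - dissipation (x1 - x0) (v1 - v0) (x1 - z0).
Proof.
move=> E0 E1 Emu sigma_ge0 mono v1D v0X.
have := energy_identity (x1 - z0) (z1 - z0) (x1 - x0) v1 (v1 - v0) mu1.
cbv zeta.
have -> : x1 - z0 - (z1 - z0) = x1 - z1 by vector_field.
have -> : x1 - z0 - (x1 - x0) = x0 - z0 by vector_field.
have -> : x1 - z0 + Q *m (x1 - x0) + (v1 - v0) = z0 - zz.
  move: E0 E1; rewrite mulmxDr mulmxN Emu.
  move: (Q *m x0) (Q *m x1) => q0 q1 E0 E1.
  apply/matrixP => i j.
  have := congr1 (fun M : 'cV[R]_n => M i j) E0.
  have := congr1 (fun M : 'cV[R]_n => M i j) E1.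
  by rewrite !mxE; lra.
have -> : x0 - z0 + (z0 - zz) = x0 - zz by vector_field.
have -> : mu1 - (x1 - z1) = mu0 by rewrite Emu addrK.
have -> : v1 - (v1 - v0) = v0 by vector_field.
have -> : - (v1 + mu1 + (z1 - z0)) = Q *m x1 + b.
  by apply/eqP; rewrite eq_sym -addr_eq0 -[X in _ == X]E1 !addrA.
have := quadB x1 (x1 - x0).
have -> : x1 - (x1 - x0) = x0 by vector_field.
move=> Equad.
have Emono : dotp (mu1 - mu0) (z1 - z0) = dotp (x1 - z1) (z1 - z0).
  by rewrite Emu addrC addKr.
have Esig : dotp mu1 (z0 - z1) = - dotp mu1 (z1 - z0) by rewrite -opprB dotpNr.
rewrite /energy; lra.
Qed.

(** Since p = u + (2/3) (X - H X) - (2/3) w, the terms in u, X and w control p;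
    the constants are not sharp. *)
Lemma dissipation_lb (delta : R) X w p : 0 < delta <= 1 ->
    (forall u, delta * dotp u u <= dotp u (hess u) <= 5 / 2 * dotp u u) ->
    (forall u, delta * dotp u u
       <= 5 * dotp u (hess u) - 2 * dotp (hess u) (hess u)) ->
  delta / 240 * dotp p p <= dissipation X w p.
Proof.
move=> /andP[d0 d1] hess_bnd hess2_bnd; rewrite /dissipation.
set u := p - _ + _; set y := w + _.
have /andP[u1 _] := hess_bnd u.
have /andP[_ y2] := hess_bnd y.
have /andP[_ X2] := hess_bnd X.
have HX := hess2_bnd X.
have : dotp p p <= 3 * dotp u u + 8 / 3 * dotp X X
    + 8 / 3 * dotp (hess X) (hess X) + 4 / 3 * dotp w w.
  rewrite /dotp !mulr_sumr -!big_split /=; apply: ler_sum => i _.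
  have -> : p i 0 = u i 0 + 2 / 3 * (X i 0 - hess X i 0) - 2 / 3 * w i 0.
    by rewrite /u; move: (hess X) => hX; rewrite !mxE; field.
  move: (u i 0) (X i 0) (hess X i 0) (w i 0) => a e f c.
  have := sqr_ge0 (a - 2 / 3 * (e - f)); have := sqr_ge0 (a + 2 / 3 * c).
  have := sqr_ge0 (2 / 3 * (e - f) + 2 / 3 * c); have := sqr_ge0 (e + f).
  by nra.
move=> p_le.
have w_ge0 := dotp_ge0 w; have X_ge0 := dotp_ge0 X; have u_ge0 := dotp_ge0 u.
have dX_ge0 : 0 <= delta * dotp X X by rewrite mulr_ge0 // ltW.
have du_ge0 : 0 <= delta * dotp u u by rewrite mulr_ge0 // ltW.
have dw : delta * dotp w w <= dotp w w by rewrite ler_piMl.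
have dp : delta * dotp p p <= delta * (3 * dotp u u + 8 / 3 * dotp X X
    + 8 / 3 * dotp (hess X) (hess X) + 4 / 3 * dotp w w).
  by rewrite ler_wpM2l // ltW.
(* Both hypotheses on H together bound H X by X. *)
have h_le : dotp (hess X) (hess X) <= 25 / 4 * dotp X X.
  by move: HX X2 dX_ge0; clear; move: (delta * _) => dX; lra.
have dh : delta * dotp (hess X) (hess X) <= 25 / 4 * (delta * dotp X X).
  by rewrite mulrCA ler_wpM2l ?(ltW d0).
have -> : delta / 240 * dotp p p = delta * dotp p p / 240 by field.
move: dp u1 HX y2 X2 w_ge0 X_ge0 u_ge0 dX_ge0 du_ge0 dw dh; clear.
rewrite !mulrDr !(mulrCA delta).
move: (delta * dotp p p) (delta * dotp u u) (delta * dotp X X)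
  (delta * dotp w w) (delta * dotp (hess X) _) => pp uu XX ww hh.
by lra.
Qed.

Lemma energy_lb x zprev z mu v (hz : R) :
    (forall u, 0 <= dotp u (hess u)) -> 0 <= dotp v (x - z) ->
  quad x + hz + dotp mu (x - z) <= energy x zprev z mu v hz.
Proof.
move=> hess_ge0 vxz; set p := x - zprev.
have p_ge0 : 0 <= dotp p (Q *m p) + 1 / 2 * dotp p p.
  by rewrite -dotpZr -dotpDr hess_ge0.
have D_ge0 := dotp_ge0 (z - zprev).
by rewrite /energy -/p dotpDl dotpZl; lra.
Qed.
End Energy.

(** * Spectral consequences of the step-size condition *)

Section Spectrum.
Variables (R : realType) (n : nat) (Q : 'M[R]_n) (C gamma : R).
Hypothesis C_gt0 : 0 < C.
Hypothesis Q_lip : forall u, dotp (Q *m u) (Q *m u) <= C ^+ 2 * dotp u u.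
Hypothesis Q_sc : forall u, (gamma - 1) * dotp u u <= dotp u (Q *m u).
Hypothesis C_le1 : C <= 1.
Hypothesis gammaC : 2 * C ^+ 2 < gamma.

(** Expanding |C u - Q u|^2 >= 0 and |C u + Q u|^2 >= 0 replaces the
    Cauchy-Schwarz inequality. *)
Lemma quad_form_bound u : `|dotp u (Q *m u)| <= C * dotp u u.
Proof.
have := Q_lip u.
have := dotp_ge0 (C *: u - Q *m u); have := dotp_ge0 (C *: u + Q *m u).
rewrite !dotpE (dotpC (Q *m u) u) ler_norml.
move: (dotp u u) (dotp u _) (dotp _ _) => N q s s1 s2 hs.
by apply/andP; split; rewrite -(ler_pM2l C_gt0); nra.
Qed.

(** For gamma > 1/2 strong convexity alone keeps H away from 0. Otherwise
    2 C^2 < gamma <= 1/2 forces C < 1/2, and the Lipschitz bound does it. The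
    estimate of H (5 - 2 H) = 2 + 3 Q - 2 Q^2 follows the same cases. *)
Lemma hess_bounds : exists2 delta, 0 < delta <= 1 &
  (forall u, delta * dotp u u <= dotp u (hess Q u) <= 5 / 2 * dotp u u) /\
  (forall u, delta * dotp u u
     <= 5 * dotp u (hess Q u) - 2 * dotp (hess Q u) (hess Q u)).
Proof.
have [delta [d0 d1 dq]] : exists delta, [/\ 0 < delta, delta <= 1 &
    forall N q s, 0 <= N -> s <= C ^+ 2 * N -> (gamma - 1) * N <= q ->
      - (C * N) <= q -> q <= C * N ->
      delta * N <= q + 1 / 2 * N /\ delta * N <= 2 * N + 3 * q - 2 * s].
  have [gamma_gt|gamma_le] := ltP (1 / 2) gamma.
    exists (Num.min 1 (gamma - 1 / 2)).
    split=> [||N q s N0 hs hg hl hu]; first by rewrite lt_min; lra.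
      by rewrite ge_min lexx.
    have : Num.min 1 (gamma - 1 / 2) * N <= (gamma - 1 / 2) * N.
      by rewrite ler_wpM2r // ge_min lexx orbT.
    have : 0 <= (gamma - 2 * C ^+ 2) * N by rewrite mulr_ge0 // subr_ge0 ltW.
    have : 0 <= (gamma - 1 / 2) * N by rewrite mulr_ge0 // subr_ge0 ltW.
    move: hs hg; rewrite !mulrBl -!mulrA mul1r.
    move: (C ^+ 2 * N) (gamma * N) (Num.min _ _ * N) => c2N gN dN.
    by split; lra.
  have C_lt : C < 1 / 2.
    rewrite ltNge; apply/negP => C_ge.
    have : 0 <= (C - 1 / 2) * (C + 1 / 2) by apply: mulr_ge0; lra.
    by move: gammaC gamma_le; rewrite expr2 => *; nra.
  exists (1 / 2 - C); split=> [||N q s N0 hs hg hl hu].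
  - by lra.
  - by have := C_gt0; lra.
  have : 0 <= (1 / 2 - C) * C * N by rewrite !mulr_ge0 ?subr_ge0 // ltW.
  have : 0 <= (1 / 2 - C) * N by rewrite mulr_ge0 // subr_ge0 ltW.
  move: hs hl; rewrite expr2 !mulrBl -!mulrA.
  move: (C * (C * N)) (C * N) => c2N cN.
  by split; lra.
exists delta; first by rewrite d0.
have main u : let N := dotp u u in let q := dotp u (Q *m u) in
    let s := dotp (Q *m u) (Q *m u) in
    [/\ dotp u (hess Q u) = q + 1 / 2 * N,
      dotp (hess Q u) (hess Q u) = s + q + 1 / 4 * N, q <= N,
      delta * N <= q + 1 / 2 * N & delta * N <= 2 * N + 3 * q - 2 * s].
  move=> N q s; have := quad_form_bound u; rewrite ler_norml => /andP[h1 h2].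
  have N0 : 0 <= N := dotp_ge0 u.
  have [h3 h4] := dq N q s N0 (Q_lip u) (Q_sc u) h1 h2.
  split=> //; rewrite /hess ?dotpE ?(dotpC (Q *m u) u) -/N -/q -/s; [lra|lra|].
  by apply: le_trans h2 _; rewrite ler_piMl.
split=> u; have [E1 E2 h1 h2 h3] := main u; have N0 := dotp_ge0 u.
  by rewrite E1; apply/andP; split => //; lra.
by rewrite E1 E2; apply: le_trans h3 _; lra.
Qed.

End Spectrum.

(** * Compactness and continuity *)

Section CompactLimits.
Variables (R : realType) (T : topologicalType).

(** A point of the compact set outside the zero set of the residuals has a
    neighbourhood on which some residual stays above a positive constant, and
    the sequence eventually leaves it; finitely many neighbourhoods cover. *)
Lemma compact_eventually (S : set (T -> R)) (C U : set T) (y : nat -> T) :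
    compact C -> (forall f, S f -> continuous f) -> (forall t, C (y t)) ->
    (forall f e, S f -> 0 < e -> \forall t \near \oo, f (y t) <= e) ->
    open U -> C `&` [set q | forall f, S f -> f q <= 0] `<=` U ->
  \forall t \near \oo, U (y t).
Proof.
move=> cptC Scont yC fy openU KU.
have /compact_near_coveringP ncC := cptC.
have: \forall t \near \oo, C `<=` [set q | y t = q -> U q].
  apply: ncC => q Cq.
  have [Kq|/existsNP[f /not_implyP[Sf fq]]] :=
      pselect (forall f, S f -> f q <= 0).
    have Uq : nbhs q U by apply: open_nbhs_nbhs; split => //; exact: KU.
    exists (U, setT) => [|[q' t] [/= Uq' _] _ //].
    by split => //=; exact: filterT.
  move/negP: fq; rewrite -ltNge => fq.
  have fq2 : 0 < f q / 2 by rewrite divr_gt0.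
  have nfq : nbhs q [set q' | f q / 2 < f q'].
    apply: (Scont f Sf q [set r : R | f q / 2 < r]); apply: open_nbhs_nbhs.
    by split; [exact: open_gt | rewrite /=; lra].
  have nt := fy f _ Sf fq2.
  exists ([set q' | f q / 2 < f q'], [set t | f (y t) <= f q / 2]) => //.
  by move=> [q' t] [/= fq' ft] yq; move: ft; rewrite yq leNgt fq'.
by apply: filterS => t CU; exact: (CU (y t)).
Qed.
End CompactLimits.

Section VectorTopology.
Variables (R : realType) (n : nat).

Lemma box_compact (r : R) : compact (@box R n r).
Proof.
have -> : @box R n r
    = trmx @` [set v : 'rV[R]_n | forall i, `[- r, r]%classic (v ord0 i)].
  apply/seteqP; split => [x bx|_ [v vi <-] i] /=.
    by exists x^T => [i|]; rewrite ?trmxK //= mxE in_itv /=; exact: bx.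
  by rewrite mxE; have := vi i; rewrite /= in_itv.
apply: continuous_compact; last first.
  apply: (@rV_compact R n (fun=> `[- r, r]%classic)) => i.
  exact: segment_compact.
apply: continuous_subspaceT => v A [P nP PA].
exists (fun i j => P j i) => [i j|w wP]; first by have := nP j i; rewrite mxE.
by apply: PA => i j; rewrite mxE; exact: wP.
Qed.

End VectorTopology.
Section Continuity.
Variables (R : realType) (n : nat) (T : topologicalType).
Implicit Types (f g : T -> 'cV[R]_n).

Lemma dotp_continuous f g :
    (forall i, continuous (fun q => f q i 0)) ->
    (forall i, continuous (fun q => g q i 0)) ->
  continuous (fun q => dotp (f q) (g q)).
Proof.
move=> cf cg; apply: continuous_big => [|i _ q]; first exact: add_continuous.
by apply: continuousM; [exact: cf|exact: cg].
Qed.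

Lemma norm1_continuous f :
    (forall i, continuous (fun q => f q i 0)) ->
  continuous (fun q => norm1 (f q)).
Proof.
move=> cf; apply: continuous_big => [|i _ q]; first exact: add_continuous.
by apply: continuous_comp; [exact: cf|exact: norm_continuous].
Qed.

Lemma norm2_continuous f :
    (forall i, continuous (fun q => f q i 0)) ->
  continuous (fun q => norm2 (f q)).
Proof.
move=> cf q; apply: (@continuous_comp _ _ _ (fun q => dotp (f q) (f q)) Num.sqrt).
  exact: (dotp_continuous cf cf).
by apply: sqrt_continuous.
Qed.

Lemma mulmx_coord_continuous m (A : 'M[R]_(m, n)) f :
    (forall i, continuous (fun q => f q i 0)) ->
  forall i, continuous (fun q => (A *m f q) i 0).
Proof.
move=> cf i.
have -> : (fun q => (A *m f q) i 0) = (fun q => \sum_j A i j * f q j 0).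
  by apply/funext => q; rewrite mxE.
apply: continuous_big => [|j _ q]; first exact: add_continuous.
by apply: continuousM; [exact: cst_continuous|exact: cf].
Qed.

End Continuity.

(** * The smooth part of the objective *)

Section Objective.
Variables (R : realType) (m n : nat).
Variables (A : 'M[R]_(m, n)) (y : 'cV[R]_m) (lambda : R).
Implicit Types (u v x : 'cV[R]_n).

Definition hessian_g : 'M[R]_n := A^T *m A - lambda%:M.
Definition lin_g : 'cV[R]_n := - (A^T *m y).

Lemma hessian_g_sym : hessian_g^T = hessian_g.
Proof.
by rewrite /hessian_g linearB /= trmx_mul trmxK tr_scalar_mx.
Qed.

Lemma obj_gE u : obj_g A y lambda u = quad hessian_g lin_g u + 1 / 2 * dotp y y.
Proof.
rewrite /obj_g !norm2_sqr /quad /hessian_g /lin_g mulmxBl mul_scalar_mx -mulmxA.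
have E1 : dotp (A^T *m y) u = dotp y (A *m u) by rewrite dotp_mulmx.
have E2 : dotp u (A^T *m (A *m u)) = dotp (A *m u) (A *m u).
  by rewrite dotp_mulmx trmxK.
by rewrite !dotpE E1 E2 (dotpC (A *m u) y); lra.
Qed.

(** The difference quotient of a quadratic along a direction is affine in the
    step. *)
Lemma grad_obj_g x : grad (obj_g A y lambda) x = hessian_g *m x + lin_g.
Proof.
apply/colP => i; rewrite [LHS]mxE.
set e := delta_mx i 0; set q := quad hessian_g lin_g.
have dotp_e u : dotp u e = u i 0.
  rewrite /dotp (bigD1 i) //= big1 ?addr0 => [|j /negPf ji].
    by rewrite mxE !eqxx mulr1.
  by rewrite mxE ji mulr0.
suff E (h : R) : h != 0 ->
    h^-1 *: (obj_g A y lambda (h *: e + x) - obj_g A y lambda x)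
    = (hessian_g *m x + lin_g) i 0 + h / 2 * dotp e (hessian_g *m e).
  apply: cvg_lim => //; move: E.
  set a := (hessian_g *m x + lin_g) i 0; set k := dotp e _ => E.
  have lim : (fun h : R => a + h / 2 * k) @ 0^' --> a.
    have lim0 : (fun h : R => a + h / 2 * k) @ 0^' --> a + 0 / 2 * k.
      apply: cvgD; first exact: cvg_cst.
      apply: cvgM; last exact: cvg_cst.
      by apply: cvgM; [exact: nbhs_dnbhs|exact: cvg_cst].
    by move: lim0; rewrite !mul0r addr0.
  apply: cvg_trans lim; apply: near_eq_cvg; near=> h; apply/esym/E.
  by near: h; exact: nbhs_dnbhs_neq.
move=> h0; rewrite !obj_gE -/q opprD addrACA subrr addr0.
have := quadB lin_g hessian_g_sym (h *: e + x) (h *: e).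
have -> : h *: e + x - h *: e = x by rewrite addrAC subrr add0r.
rewrite -/q => ->.
rewrite mulmxDr -!scalemxAr {q}.
move: (hessian_g *m x) (hessian_g *m e) lin_g => a c l.
rewrite !(dotpE, dotp_e) (dotpC e c) dotp_e !mxE /GRing.scale /=.
by field.
Unshelve. all: by end_near. Qed.

End Objective.

Section Hypotheses.
Variables (R : realType) (m n : nat) (A : 'M[R]_(m, n)) (y : 'cV[R]_m).
Variables (lambda d alpha C gamma : R).
Hypotheses (C_gt0 : 0 < C) (alpha_gt0 : 0 < alpha).
Local Notation Q := (hessian_g A lambda).

Lemma hessian_g_lip (u : 'cV[R]_n) : lipschitz2 C (grad (obj_g A y lambda)) ->
  dotp (Q *m u) (Q *m u) <= C ^+ 2 * dotp u u.
Proof.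
move=> /(_ u 0); rewrite !grad_obj_g mulmx0 add0r addrK subr0 => lip.
rewrite -!norm2_sqr -exprMn ler_sqr ?nnegrE ?norm2_ge0 //.
by rewrite mulr_ge0 ?norm2_ge0 // ltW.
Qed.

(** The augmented Lagrangian is quadratic in its first argument, so testing
    strong convexity at u and - u gives its Hessian along u. *)
Lemma hessian_g_sc (u : 'cV[R]_n) :
    strongly_convex gamma (fun u => aug_lagrangian A y lambda d alpha u 0 0) ->
  (gamma - alpha) * dotp u u <= dotp u (Q *m u).
Proof.
have half01 : 0 <= (1 / 2 : R) <= 1 by apply/andP; split; lra.
move=> /(_ u (- u) _ half01).
have -> : (1 / 2 : R) *: u + (1 - 1 / 2) *: - u = 0.
  by apply/matrixP => i j; rewrite !mxE; field.
rewrite opprK /aug_lagrangian !obj_gE /quad !subr0 !norm2_sqr.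
rewrite !(mulmxDr, mulmxN, mulmx0, dotpE, dotp0l, dotpC _ 0).
move: (obj_h _ _ _) (dotp u _) (dotp u u) (dotp _ u) (dotp y y) => h q N l c.
by lra.
Qed.

Lemma scaled_hess_bounds : lipschitz2 C (grad (obj_g A y lambda)) ->
    (forall w v : 'cV[R]_n, strongly_convex gamma
       (fun u => aug_lagrangian A y lambda d alpha u w v)) ->
    2 * C ^+ 2 < alpha * gamma -> C <= alpha ->
  exists2 delta, 0 < delta <= 1 &
  (forall u : 'cV[R]_n, delta * dotp u u <= dotp u (hess (alpha^-1 *: Q) u)
      <= 5 / 2 * dotp u u) /\
  (forall u : 'cV[R]_n, delta * dotp u u
     <= 5 * dotp u (hess (alpha^-1 *: Q) u)
        - 2 * dotp (hess (alpha^-1 *: Q) u) (hess (alpha^-1 *: Q) u)).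
Proof.
move=> lip sc gammaC C_le.
apply: (@hess_bounds _ _ _ (C / alpha) (gamma / alpha)).
- by rewrite divr_gt0.
- move=> u; rewrite -scalemxAl dotpZl dotpZr.
  have -> : (C / alpha) ^+ 2 * dotp u u
      = alpha^-1 * (alpha^-1 * (C ^+ 2 * dotp u u)).
    by field; rewrite gt_eqF.
  by rewrite !ler_wpM2l ?invr_ge0 ?(ltW alpha_gt0) // hessian_g_lip.
- move=> u; rewrite -scalemxAl dotpZr.
  have -> : gamma / alpha - 1 = alpha^-1 * (gamma - alpha).
    by field; rewrite gt_eqF.
  rewrite -mulrA ler_wpM2l ?invr_ge0 ?(ltW alpha_gt0) //.
  by apply: hessian_g_sc; exact: sc.
- by rewrite ler_pdivrMr // mul1r.
- rewrite -(ltr_pM2l (exprn_gt0 2 alpha_gt0)).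
  have -> : alpha ^+ 2 * (2 * (C / alpha) ^+ 2) = 2 * C ^+ 2.
    by field; rewrite gt_eqF.
  have -> : alpha ^+ 2 * (gamma / alpha) = alpha * gamma.
    by field; rewrite gt_eqF.
  by [].
Qed.
End Hypotheses.

(** * First-order conditions on a box *)

Section Optimality.
Variables (R : realType).

Lemma first_order_ge0 (c k : R) :
  (forall s : R, 0 < s <= 1 -> 0 <= s * c + s ^+ 2 * k) -> 0 <= c.
Proof.
move=> ck; rewrite leNgt; apply/negP => c_lt0.
have k1 : 0 < `|k| + 1 by rewrite ltr_pwDr.
(* A step for which the quadratic term uses up at most half of the decrease. *)
pose s := Num.min 1 (- c / 2 / (`|k| + 1)).
have s_gt0 : 0 < s by rewrite lt_min ltr01 !divr_gt0 // oppr_gt0.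
have s_le1 : s <= 1 by rewrite ge_min lexx.
have /ck : 0 < s <= 1 by rewrite s_gt0.
have sk : s * (`|k| + 1) <= - c / 2.
  by rewrite -ler_pdivlMr // ge_min lexx orbT.
have kk : s * k <= s * (`|k| + 1).
  by rewrite ler_wpM2l ?(ltW s_gt0) // (le_trans (ler_norm k)) // lerDl.
rewrite expr2 -mulrA -mulrDr pmulr_rge0 // => ?; lra.
Qed.

(** One coordinate of the z-step. The first-order condition on [-d, d] at c = 0
    gives kappa |z| <= m' z. It bounds m' by kappa on the side where z can still
    move outwards; if z is the endpoint d, then m' <= m because x <= d, and the
    bound on the previous multiplier m is inherited. The two together make m' a
    subgradient of kappa |.| at z on the whole line. *)
Lemma shrink_step (d kappa alpha m x z : R) : 0 < d -> 0 < alpha ->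
    `|z| <= d -> `|x| <= d -> `|m| <= kappa ->
    (forall c, `|c| <= d -> kappa * `|z| - m * z + alpha / 2 * (x - z) ^+ 2
                         <= kappa * `|c| - m * c + alpha / 2 * (x - c) ^+ 2) ->
  let m' := m + alpha * (x - z) in `|m'| <= kappa /\ m' * z = kappa * `|z|.
Proof.
move=> d0 a0 zd xd mk zmin m'.
have k0 : 0 <= kappa by apply: le_trans mk.
have vi c : `|c| <= d -> m' * (c - z) <= kappa * `|c| - kappa * `|z|.
  move=> cd; rewrite -subr_ge0.
  apply: (@first_order_ge0 _ (alpha / 2 * (c - z) ^+ 2)).
  move=> s /andP[s0 s1].
  have conv : `|z + s * (c - z)| <= (1 - s) * `|z| + s * `|c|.
    have -> : z + s * (c - z) = (1 - s) * z + s * c by ring.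
    apply: le_trans (ler_normD _ _) _.
    by rewrite !normrM (ger0_norm (ltW s0)) (@ger0_norm _ (1 - s)) ?subr_ge0.
  have /zmin : `|z + s * (c - z)| <= d.
    apply: le_trans conv _.
    have -> : d = (1 - s) * d + s * d by ring.
    by apply: lerD; rewrite ler_wpM2l // ?subr_ge0 // ltW.
  have : kappa * `|z + s * (c - z)| <= kappa * ((1 - s) * `|z| + s * `|c|).
    by rewrite ler_wpM2l.
  by rewrite /m'; move: (`|z|) (`|c|) (`|_|) => az ac as_; nra.
have m'z : kappa * `|z| <= m' * z.
  by have := vi 0; rewrite normr0 sub0r => /(_ (ltW d0)); lra.
have m'k : `|m'| <= kappa.
  rewrite ler_norml; move: zd xd mk; rewrite !ler_norml.
  move=> /andP[zd1 zd2] /andP[xd1 xd2] /andP[mk1 mk2].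
  apply/andP; split.
    have [zE|zNE] := eqVneq z (- d).
      have : 0 <= alpha * (x + d) by rewrite mulr_ge0 ?(ltW a0) //; lra.
      by rewrite /m' zE opprK; lra.
    have dz : 0 < z + d by rewrite lt_neqAle eq_sym addr_eq0 zNE /=; lra.
    have := vi (- d); rewrite normrN (gtr0_norm d0) => /(_ (lexx d)).
    have : - z <= `|z| by rewrite -normrN ler_norm.
    move=> h1 h2; rewrite -(ler_pM2r dz).
    have : kappa * (- z) <= kappa * `|z| by rewrite ler_wpM2l.
    by move: h2; rewrite mulrBr mulNr; nra.
  have [zE|zNE] := eqVneq z d.
    have : 0 <= alpha * (d - x) by rewrite mulr_ge0 ?(ltW a0) //; lra.
    by rewrite /m' zE; lra.
  have dz : 0 < d - z by rewrite lt_neqAle eq_sym subr_eq0 eq_sym zNE /=; lra.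
  have := vi d; rewrite (gtr0_norm d0) => /(_ (lexx d)).
  move=> h2; rewrite -(ler_pM2r dz).
  have : kappa * z <= kappa * `|z| by rewrite ler_wpM2l // ler_norm.
  by lra.
split=> //; apply/eqP; rewrite eq_le m'z andbT.
by rewrite (le_trans (ler_norm _)) // normrM ler_wpM2r.
Qed.

End Optimality.

Section BoxOptimality.
Variables (R : realType) (n : nat).
Implicit Types (u x z mu : 'cV[R]_n) (Q : 'M[R]_n).

Lemma box_segment (d s : R) x u : 0 < s <= 1 -> box d x -> box d u ->
  box d (x + s *: (u - x)).
Proof.
move=> /andP[s0 s1] bx bu i; rewrite !mxE.
have := bx i; have := bu i.
move: (x i 0) (u i 0) => a c /andP[c1 c2] /andP[a1 a2].
have -> : a + s * (c - a) = (1 - s) * a + s * c by ring.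
have t0 : 0 <= 1 - s by rewrite subr_ge0.
have := ler_wpM2l t0 a1; have := ler_wpM2l t0 a2.
have := ler_wpM2l (ltW s0) c1; have := ler_wpM2l (ltW s0) c2.
rewrite !mulrN !mulrBl !mul1r; move: (s * d) (s * a) (s * c) => sd sa sc *.
by apply/andP; split; lra.
Qed.

Lemma argmin_quad_box (d : R) Q b (c : R) (f : 'cV[R]_n -> R) x :
    Q^T = Q -> (forall u, f u = quad Q b u + c) -> is_argmin (box d) f x ->
  forall u, box d u -> 0 <= dotp (Q *m x + b) (u - x).
Proof.
move=> Qsym fE [bx xmin] u bu.
have bX (s : R) : 0 < s <= 1 -> box d (x + s *: (u - x)).
  by move=> s01; exact: box_segment.
move: (u - x) bX => X bX.
apply: (@first_order_ge0 _ _ (1 / 2 * dotp X (Q *m X))) => s s01.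
have := xmin _ (bX s s01); rewrite !fE lerD2r -subr_ge0.
have := quadB b Qsym (x + s *: X) (s *: X); rewrite addrK => ->.
rewrite mulmxDr -!scalemxAr !dotpE (dotpC (Q *m X) X).
move: (dotp X _) (dotp _ X) (dotp b X) => k c1 c2.
have -> : s * (c1 + c2) + s ^+ 2 * (1 / 2 * k)
    = s * (c1 + s * k + c2) - 1 / 2 * (s * (s * k)) by field.
by [].
Qed.

(** Changing a single coordinate of the minimizer stays inside the box. *)
Lemma argmin_separable_box (d : R) (phi : 'I_n -> R -> R) (f : 'cV[R]_n -> R)
    (c : R) z :
    (forall u, f u = \sum_i phi i (u i 0) + c) -> is_argmin (box d) f z ->
  forall i t, `|t| <= d -> phi i (z i 0) <= phi i t.
Proof.
move=> fE [bz zmin] i t td.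
pose w : 'cV[R]_n := \col_j (if j == i then t else z j 0).
have /zmin : box d w.
  move=> j; rewrite mxE; case: eqP => _; last exact: bz.
  by rewrite -ler_norml.
have eq_rest :
    \sum_(j | j != i) phi j (w j 0) = \sum_(j | j != i) phi j (z j 0).
  by apply: eq_bigr => j /negPf ji; rewrite mxE ji.
rewrite !fE lerD2r (bigD1 i) //= [leRHS](bigD1 i) //= eq_rest lerD2r.
by rewrite mxE eqxx.
Qed.

Lemma dotp_le_norm1 (r : R) u x : box r u -> dotp u x <= r * norm1 x.
Proof.
move=> bu; rewrite /norm1 mulr_sumr; apply: ler_sum => i _.
rewrite (le_trans (ler_norm _)) // normrM ler_wpM2r //.
by rewrite ler_norml; exact: bu.
Qed.

Lemma norm1N u : norm1 (- u) = norm1 u.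
Proof. by apply: eq_bigr => i _; rewrite mxE normrN. Qed.

Lemma norm1D u x : norm1 (u + x) <= norm1 u + norm1 x.
Proof.
by rewrite /norm1 -big_split; apply: ler_sum => i _; rewrite mxE ler_normD.
Qed.

Lemma norm1_le_norm2 u : norm1 u <= n%:R * norm2 u.
Proof.
have : norm1 u <= \sum_(i < n) norm2 u.
  apply: ler_sum => i _.
  rewrite -(ger0_norm (norm2_ge0 u)) -ler_sqr ?nnegrE //.
  rewrite !real_normK ?num_real //.
  rewrite norm2_sqr /dotp (bigD1 i) //= expr2 lerDl.
  by apply: sumr_ge0 => j _; exact: sqr_ge0.
by rewrite sumr_const card_ord mulr_natl.
Qed.

End BoxOptimality.

Lemma dissipated_cvg0 (R : realType) (E r : nat -> R) (c M : R) : 0 < c ->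
    (forall t, 0 <= r t) -> (forall t, E t.+1 <= E t - c * r t) ->
    (forall t, M <= E t) ->
  r t @[t --> \oo] --> (0 : R).
Proof.
move=> c0 r0 Edec EM.
have Ecvg : cvgn E.
  apply: nonincreasing_is_cvgn; last by exists M => _ [t _ <-].
  apply/nonincreasing_seqP => t; apply: le_trans (Edec t) _.
  by rewrite lerBlDr lerDl mulr_ge0 // ltW.
have dE0 : (c^-1 * (E t - E t.+1)) @[t --> \oo] --> (0 : R).
  rewrite -(mulr0 c^-1) -(subrr (limn E)).
  apply: cvgM; first exact: cvg_cst.
  by apply: cvgB => //; rewrite (cvg_shiftS E).
apply: squeeze_cvgr dE0; last exact: cvg_cst.
near=> t; rewrite r0 /= mulrC ler_pdivlMr // mulrC.
by have := Edec t; lra.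
Unshelve. all: by end_near. Qed.

(** * The stationary set *)

Section Stationarity.
Variables (R : realType) (m n : nat).
Variables (A : 'M[R]_(m, n)) (y : 'cV[R]_m) (lambda d : R).
Hypothesis kappa_ge0 : 0 <= lambda * d.
Local Notation T := ('cV[R]_n * 'cV[R]_n)%type.
Local Notation Q := (hessian_g A lambda).
Local Notation b := (lin_g A y).
Implicit Types (q : T) (u x : 'cV[R]_n).

Definition dual_slack q : R := lambda * d * norm1 q.1 - dotp q.2 q.1.

Definition variational_gap u q : R := dotp (Q *m q.1 + b + q.2) (q.1 - u).

(** The first residual vanishes when mu, with entries bounded by lambda d, is a
    subgradient of h at x; the second family encodes that minus the gradient of
    the smooth part is normal to the box. *)
Definition kkt_residuals : set (T -> R) :=
  [set dual_slack] `|` [set variational_gap u | u in box d].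

Definition kkt : set T :=
  (box d `*` box (lambda * d))
  `&` [set q | forall f, kkt_residuals f -> f q <= 0].

(** In the direction from the stationary set, testing the subgradient inequality
    at x + t e_i with t = 1 and t = -1 bounds the entries of the subgradient. *)
Lemma stationaryE : stationary A y lambda d = fst @` kkt.
Proof.
apply/seteqP; split => [x [bx [s [v [s_sub [_ v_normal] sv]]]]
  |_ [[x mu] [[/= bx bmu] res] <-]].
  rewrite grad_obj_g in sv.
  have sE : Q *m x + b + s = - v by apply/eqP; rewrite -addr_eq0 sv.
  exists (x, s) => //; split=> [|f].
    split=> //= i.
    have step t : t * s i 0 <= lambda * d * `|t|.
      have := s_sub (x + t *: delta_mx i 0).
      have -> : x + t *: delta_mx i 0 - x = t *: delta_mx i 0.
        by rewrite addrAC subrr add0r.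
      rewrite /obj_h => h_sub.
      have : norm1 (x + t *: delta_mx i 0) <= norm1 x + `|t|.
        apply: le_trans (norm1D _ _) _; rewrite lerD2l /norm1 (bigD1 i) //=.
        rewrite big1 => [|j /negPf ji]; first by rewrite !mxE !eqxx mulr1 addr0.
        by rewrite !mxE ji mulr0 normr0.
      move=> /(ler_wpM2l kappa_ge0); rewrite mulrDr => h_le.
      have <- : dotp s (t *: delta_mx i 0) = t * s i 0.
        rewrite dotpZr /dotp (bigD1 i) //= big1 => [|j /negPf ji].
          by rewrite mxE !eqxx mulr1 addr0.
        by rewrite mxE ji mulr0.
      by rewrite -(lerD2l (lambda * d * norm1 x)) (le_trans h_sub).
    have := step 1; have := step (- 1); rewrite normrN normr1 => h1 h2.
    by apply/andP; split; lra.
  case=> [->|[u bu <-]]; rewrite /dual_slack /variational_gap /=.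
    have := s_sub 0; rewrite sub0r dotpNr /obj_h subr_le0 => h0.
    have n0 : norm1 (0 : 'cV[R]_n) = 0.
      by rewrite /norm1 big1 // => i _; rewrite mxE normr0.
    by move: h0; rewrite n0 mulr0; lra.
  by rewrite sE dotpNl -dotpNr opprB; exact: v_normal.
split=> //; exists mu, (- (Q *m x + b + mu)); split.
- move=> u; rewrite /obj_h; have := res dual_slack (or_introl erefl).
  rewrite /dual_slack /= => h0; have := dotp_le_norm1 u bmu.
  by rewrite dotpDr dotpNr; lra.
- split=> // u bu; have := res _ (or_intror (ex_intro2 _ _ u bu erefl)).
  by rewrite /variational_gap /= dotpNl -dotpNr opprB.
- by rewrite grad_obj_g subrr.
Qed.

Lemma fst_coord_continuous i : continuous (fun q : T => q.1 i 0).
Proof.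
move=> q; apply: (@continuous_comp _ _ _ fst (fun M : 'cV[R]_n => M i 0)).
  exact: cvg_fst.
exact: coord_continuous.
Qed.

Lemma snd_coord_continuous i : continuous (fun q : T => q.2 i 0).
Proof.
move=> q; apply: (@continuous_comp _ _ _ snd (fun M : 'cV[R]_n => M i 0)).
  exact: cvg_snd.
exact: coord_continuous.
Qed.

Lemma kkt_residuals_continuous f : kkt_residuals f -> continuous f.
Proof.
have c1 := fst_coord_continuous; have c2 := snd_coord_continuous.
case=> [->|[u bu <-]].
  have cn := norm1_continuous c1; have cd := dotp_continuous c2 c1.
  move=> q; apply: (@continuousB _ _ _ (fun q : T => lambda * d * norm1 q.1)
    (fun q : T => dotp q.2 q.1)); last exact: cd.
  by apply: continuousM; [exact: cst_continuous|exact: cn].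
have c3 i : continuous (fun q : T => (Q *m q.1) i 0).
  exact: (mulmx_coord_continuous c1).
apply: dotp_continuous => i.
  have -> : (fun q : T => (Q *m q.1 + b + q.2) i 0)
      = (fun q => (Q *m q.1) i 0 + b i 0 + q.2 i 0).
    by apply/funext => q; rewrite mxE [in X in X + _]mxE.
  move=> q; apply: (@continuousD _ _ _ (fun q : T => (Q *m q.1) i 0 + b i 0)
    (fun q : T => q.2 i 0)); last exact: c2.
  apply: (@continuousD _ _ _ (fun q : T => (Q *m q.1) i 0) (fun=> b i 0)).
    exact: c3.
  exact: cst_continuous.
have -> : (fun q : T => (q.1 - u) i 0) = (fun q => q.1 i 0 - u i 0).
  by apply/funext => q; rewrite !mxE.
move=> q; apply: (@continuousB _ _ _ (fun q : T => q.1 i 0) (fun=> u i 0)).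
  exact: c1.
exact: cst_continuous.
Qed.

Lemma kkt_compact : compact kkt.
Proof.
apply: compact_closedI; first by apply: compact_setX; exact: box_compact.
have -> : [set q : T | forall f, kkt_residuals f -> f q <= 0]
    = \bigcap_(f in kkt_residuals) [set q | f q <= 0].
  by apply/seteqP; split.
apply: closed_bigI => f /kkt_residuals_continuous cf.
apply: (@preimage_closed _ _ f [set r | r <= 0]) => [q _|]; first exact: cf.
exact: closed_le.
Qed.

(** The stationary set is a continuous image of a compact set, hence compact. *)
Lemma stationary_nearest x : stationary A y lambda d !=set0 ->
  exists p, is_argmin (stationary A y lambda d) (fun u => norm2 (x - u)) p.
Proof.
move=> Z0.
have [||p pZ pmin] := @compact_EVT_min _ R (fun u => norm2 (x - u)) _ Z0.
- rewrite stationaryE; apply: continuous_compact; last exact: kkt_compact.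
  by apply: continuous_subspaceT => q; exact: cvg_fst.
- apply: continuous_subspaceT; apply: norm2_continuous => i q.
  have -> : (fun u : 'cV[R]_n => (x - u) i 0) = (fun u => x i 0 - u i 0).
    by apply/funext => z; rewrite !mxE.
  apply: (@continuousB _ _ _ (fun=> x i 0) (fun u : 'cV[R]_n => u i 0)).
    exact: cst_continuous.
  exact: coord_continuous.
exists p; split; first by rewrite inE in pZ.
by move=> u Zu; apply: pmin; rewrite inE.
Qed.

Lemma kkt_approached (q : nat -> T) :
    (forall t, box d (q t).1) -> (forall t, box (lambda * d) (q t).2) ->
    (forall f e, kkt_residuals f -> 0 < e ->
       \forall t \near \oo, f (q t) <= e) ->
  stationary A y lambda d !=set0 /\
  forall e, 0 < e -> \forall t \near \oo,
    exists2 p, stationary A y lambda d p & norm2 ((q t).1 - p) < e.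
Proof.
move=> q1 q2 qres.
have near U : open U -> kkt `<=` U -> \forall t \near \oo, U (q t).
  move=> oU kU; apply: (compact_eventually (C := box d `*` box (lambda * d)) _
    kkt_residuals_continuous) => //.
  by apply: compact_setX; exact: box_compact.
split.
  apply/set0P/eqP => Z0.
  have /near : open (set0 : set T) by exact: open0.
  case=> [k kk|N _ /(_ N (leqnn N))//].
  have : stationary A y lambda d k.1 by rewrite stationaryE; exists k.
  by rewrite Z0.
move=> e e0.
have := near (\bigcup_(k in kkt) [set q | norm2 (q.1 - k.1) < e]).
case=> [|k kk|N _ Nq].
- apply: bigcup_open => k _.
  apply: (@open_comp _ _ (fun q : T => norm2 (q.1 - k.1)) [set r | r < e]);
    last exact: open_lt.
  move=> z _; apply: norm2_continuous => i {}z.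
  have -> : (fun q : T => (q.1 - k.1) i 0) = (fun q => q.1 i 0 - k.1 i 0).
    by apply/funext => s; rewrite !mxE.
  apply: (@continuousB _ _ _ (fun q : T => q.1 i 0) (fun=> k.1 i 0));
    last exact: cst_continuous.
  exact: fst_coord_continuous.
- exists k => //=; rewrite subrr /norm2.
  by rewrite -[X in dotp X _](scale0r 0) dotpZl mul0r sqrtr0.
exists N => // t /Nq [k kk kq]; exists k.1 => //.
by rewrite stationaryE; exists k.
Qed.

End Stationarity.

(** * Invariants and energy of the iterates *)

Section Iterates.
Variables (R : realType) (m n : nat).
Variables (A : 'M[R]_(m, n)) (y : 'cV[R]_m) (lambda d alpha : R).
Variables (x z mu : nat -> 'cV[R]_n).
Hypotheses (d_gt0 : 0 < d) (lambda_gt0 : 0 < lambda) (alpha_gt0 : 0 < alpha).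
Hypothesis xzmu : is_MADMM A y lambda d alpha x z mu.

Local Notation kappa := (lambda * d).
Local Notation Q := (hessian_g A lambda).
Local Notation b := (lin_g A y).

Let kappa_gt0 : 0 < kappa. Proof. exact: mulr_gt0. Qed.

Lemma x_box t : box d (x t.+1).
Proof. by have [_ _ /(_ t)[[]]] := xzmu. Qed.

Lemma z_box t : box d (z t).
Proof.
have [z0 _ step] := xzmu; case: t => [|t]; last by have [_ []] := step t.
by move=> i; rewrite z0 mxE oppr_le0 ltW.
Qed.

Lemma muS t : mu t.+1 = mu t + alpha *: (x t.+1 - z t.+1).
Proof. by have [_ _ /(_ t)[]] := xzmu. Qed.

Lemma aug_lagrangian_separable u w v :
  aug_lagrangian A y lambda d alpha u w v
  = \sum_i (kappa * `|w i 0| - v i 0 * w i 0 + alpha / 2 * (u i 0 - w i 0) ^+ 2)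
    + (obj_g A y lambda u + dotp v u).
Proof.
have -> : \sum_i (kappa * `|w i 0| - v i 0 * w i 0
      + alpha / 2 * (u i 0 - w i 0) ^+ 2)
    = kappa * norm1 w - dotp v w + alpha / 2 * dotp (u - w) (u - w).
  rewrite /norm1 /dotp !mulr_sumr -sumrN -!big_split /=.
  by apply: eq_bigr => i _; rewrite !mxE expr2.
by rewrite /aug_lagrangian norm2_sqr /obj_h dotpDr dotpNr; ring.
Qed.

(** The induction has to carry the bound on mu: at an endpoint of [-d, d] it is
    inherited from the previous step. *)
Lemma mu_dual t i :
  `|mu t i 0| <= kappa /\ mu t i 0 * z t i 0 = kappa * `|z t i 0|.
Proof.
have [z0 mu0 step] := xzmu.
elim: t => [|t [mu_le _]].
  by rewrite z0 mu0 !mxE normr0 !mulr0 ltW.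
have [_ zmin muE] := step t.
have -> : mu t.+1 i 0 = mu t i 0 + alpha * (x t.+1 i 0 - z t.+1 i 0).
  by rewrite muE !mxE.
apply: (@shrink_step R d) => //.
- by rewrite ler_norml; exact: z_box.
- by rewrite ler_norml; exact: x_box.
apply: (argmin_separable_box (phi := fun i c => kappa * `|c| - mu t i 0 * c
  + alpha / 2 * (x t.+1 i 0 - c) ^+ 2) _ zmin) => u.
exact: aug_lagrangian_separable.
Qed.

Lemma mu_box t : box kappa (mu t).
Proof. by move=> i; rewrite -ler_norml; have [] := mu_dual t i. Qed.

Lemma dotp_mu_z t : dotp (mu t) (z t) = kappa * norm1 (z t).
Proof.
rewrite /norm1 mulr_sumr; apply: eq_bigr => i _.
by have [] := mu_dual t i.
Qed.

Lemma mu_z_monotone t i :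
  0 <= (mu t.+1 i 0 - mu t i 0) * (z t.+1 i 0 - z t i 0).
Proof.
have [mu1 muz1] := mu_dual t.+1 i; have [mu0 muz0] := mu_dual t i.
have cross (k a c : R) : `|a| <= k -> a * c <= k * `|c|.
  by move=> ak; rewrite (le_trans (ler_norm _)) // normrM ler_wpM2r.
have := cross _ _ (z t i 0) mu1; have := cross _ _ (z t.+1 i 0) mu0.
by move: muz1 muz0; rewrite mulrBl !mulrBr; lra.
Qed.

(** The multiplier of the box constraint in the x-step, divided by alpha. *)
Definition box_mult t : 'cV[R]_n :=
  - (alpha^-1 *: (Q *m x t.+1 + b + mu t) + (x t.+1 - z t)).

Lemma box_mult_normal t u : box d u -> dotp (box_mult t) (u - x t.+1) <= 0.
Proof.
have [_ _ /(_ t)[xmin _ _]] := xzmu => bu.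
pose c := 1 / 2 * dotp y y + obj_h lambda d (z t) - dotp (mu t) (z t)
  + alpha / 2 * dotp (z t) (z t).
have augE w : aug_lagrangian A y lambda d alpha w (z t) (mu t)
    = quad (Q + alpha%:M) (b + mu t - alpha *: z t) w + c.
  rewrite /aug_lagrangian obj_gE norm2_sqr /quad /c (mulmxDl Q) mul_scalar_mx.
  rewrite !dotpE (dotpC w (z t)); move: (dotp w (Q *m w)) => wQw.
  by field.
have Qsym : (Q + alpha%:M)^T = Q + alpha%:M.
  by rewrite linearD /= hessian_g_sym tr_scalar_mx.
have := argmin_quad_box Qsym augE xmin bu.
rewrite (mulmxDl Q) mul_scalar_mx.
have -> : Q *m x t.+1 + alpha *: x t.+1 + (b + mu t - alpha *: z t)
    = - (alpha *: box_mult t).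
  rewrite /box_mult; move: (Q *m _) => q.
  by apply/matrixP => i j; rewrite !mxE; field; rewrite gt_eqF.
by rewrite dotpNl dotpZl oppr_ge0 pmulr_rle0.
Qed.

Lemma box_mult_sign t i c : `|c| <= d -> 0 <= box_mult t i 0 * (x t.+1 i 0 - c).
Proof.
move=> cd; pose u := x t.+1 + (c - x t.+1 i 0) *: delta_mx i 0.
have : box d u.
  move=> j; rewrite !mxE eqxx andbT; case: eqP => [->|_].
    by rewrite mulr1 addrC subrK -ler_norml.
  by rewrite mulr0 addr0; exact: x_box.
move=> /(box_mult_normal t).
have -> : u - x t.+1 = (c - x t.+1 i 0) *: delta_mx i 0.
  by rewrite /u addrAC subrr add0r.
move: (box_mult t) => v; rewrite dotpZr /dotp (bigD1 i) //= big1 => [|j /negPf ji].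
  by rewrite mxE !eqxx mulr1 addr0 -oppr_ge0 -mulNr opprB mulrC.
by rewrite mxE ji mulr0.
Qed.

Lemma primal_gap t : x t.+1 - z t.+1 = alpha^-1 *: mu t.+1 - alpha^-1 *: mu t.
Proof.
by rewrite -scalerBr muS addrAC subrr add0r scalerA mulVf ?gt_eqF // scale1r.
Qed.

Lemma gap_sign t i :
  0 <= (x t.+1 - z t.+1) i 0 * (z t.+1 - z t) i 0.
Proof.
rewrite primal_gap; have := mu_z_monotone t i.
move: (mu t.+1) (mu t) (z t.+1) (z t) => m1 m0 z1 z0 h.
have -> : (alpha^-1 *: m1 - alpha^-1 *: m0) i 0 * (z1 - z0) i 0
    = alpha^-1 * ((m1 i 0 - m0 i 0) * (z1 i 0 - z0 i 0)) by rewrite !mxE; ring.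
by rewrite mulr_ge0 // invr_ge0 ltW.
Qed.

(** The multiplier is normal to the box at x, so it agrees in sign with x - z
    for the old and the new z. The increment of z has in each coordinate the sign of
    x - z for the new z, or equals x - z for the old one. *)
Lemma box_mult_step_sign t : 0 <= dotp (box_mult t) (z t.+1 - z t).
Proof.
apply: sumr_ge0 => i _.
have z_norm s : `|z s i 0| <= d by rewrite ler_norml; exact: z_box.
have := box_mult_sign t i (z_norm t.+1); have := box_mult_sign t i (z_norm t).
have := gap_sign t i; move: (box_mult t) (x t.+1) (z t.+1) (z t) => v x1 z1 z0.
rewrite !mxE; move: (v i 0) (x1 i 0) (z1 i 0) (z0 i 0) => {}v {}x1 {}z1 {}z0.
move=> aD vp va; have [a0|aN0] := eqVneq (x1 - z1) 0.
  by move: vp; rewrite (_ : x1 = z1) //; lra.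
(* Multiply v D by the square of a = x - z: it becomes (v a) (a D). *)
have a2 : 0 < (x1 - z1) ^+ 2 by rewrite exprn_even_gt0.
rewrite -(pmulr_lge0 _ a2).
have -> : v * (z1 - z0) * (x1 - z1) ^+ 2
    = (v * (x1 - z1)) * ((x1 - z1) * (z1 - z0)) by ring.
exact: mulr_ge0.
Qed.

Definition scaled_energy t : R :=
  energy (alpha^-1 *: Q) (alpha^-1 *: b) (x t.+1) (z t) (z t.+1)
    (alpha^-1 *: mu t.+1) (box_mult t) (alpha^-1 * (kappa * norm1 (z t.+1))).

Lemma stationarity_in_x t :
  (alpha^-1 *: Q) *m x t.+1 + alpha^-1 *: b + box_mult t + alpha^-1 *: mu t.+1
    + (z t.+1 - z t) = 0.
Proof.
have := primal_gap t; rewrite /box_mult -scalemxAl.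
move: (Q *m x t.+1) (mu t.+1) (mu t) (x t.+1) (z t.+1) (z t).
move=> q m1 m0 x1 z1 z0 gap.
apply/matrixP => i j; have := congr1 (fun M : 'cV[R]_n => M i j) gap.
by rewrite !mxE; lra.
Qed.

Lemma scaled_energy_decrease t :
  scaled_energy t.+1 <= scaled_energy t
    - dissipation (alpha^-1 *: Q) (x t.+2 - x t.+1) (box_mult t.+1 - box_mult t)
        (x t.+2 - z t.+1).
Proof.
have ai : 0 <= alpha^-1 by rewrite invr_ge0 ltW.
apply: energy_descent.
- by rewrite linearZ /= hessian_g_sym.
- exact: stationarity_in_x.
- exact: stationarity_in_x.
- by rewrite primal_gap addrCA subrr addr0.
- rewrite dotpZl dotpDr dotpNr -mulrDr ler_wpM2l //.
  by rewrite (dotp_mu_z t.+2) addrC subrK; apply: dotp_le_norm1; exact: mu_box.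
- by rewrite -primal_gap; apply: sumr_ge0 => i _; exact: gap_sign.
- exact: box_mult_step_sign.
- exact/box_mult_normal/x_box.
Qed.

(** All quadratic terms of the energy and the term in v are nonnegative, and
    h(z) = <mu, z>; there remains g(x) + <mu, x> on bounded sets. *)
Lemma scaled_energy_lb : (forall u, 0 <= dotp u (hess (alpha^-1 *: Q) u)) ->
  exists M, forall t, M <= scaled_energy t.
Proof.
move=> hess_ge0.
exists (alpha^-1 * (- (lambda / 2 * (n%:R * d ^+ 2)) - 1 / 2 * dotp y y
  - kappa * (n%:R * d))) => t.
have vxz : 0 <= dotp (box_mult t) (x t.+1 - z t.+1).
  by have := box_mult_normal t (z_box t.+1); rewrite -opprB dotpNr oppr_le0.
apply: le_trans (energy_lb _ _ _ _ hess_ge0 vxz).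
have -> : quad (alpha^-1 *: Q) (alpha^-1 *: b) (x t.+1)
      + alpha^-1 * (kappa * norm1 (z t.+1))
      + dotp (alpha^-1 *: mu t.+1) (x t.+1 - z t.+1)
    = alpha^-1 * (obj_g A y lambda (x t.+1) - 1 / 2 * dotp y y
      + dotp (mu t.+1) (x t.+1)).
  rewrite obj_gE addrK dotpZl dotpDr dotpNr dotp_mu_z /quad -scalemxAl.
  by rewrite !dotpZr !dotpZl; ring.
rewrite ler_wpM2l ?invr_ge0 ?(ltW alpha_gt0) //.
have xn i : `|x t.+1 i 0| <= d by rewrite ler_norml; exact: x_box.
have sum_cst c : \sum_(i < n) c = n%:R * c :> R.
  by rewrite sumr_const card_ord mulr_natl.
have x2 : dotp (x t.+1) (x t.+1) <= n%:R * d ^+ 2.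
  rewrite -sum_cst; apply: ler_sum => i _.
  rewrite -expr2 -real_normK ?num_real //.
  by rewrite ler_sqr ?nnegrE // ltW.
have x1 : norm1 (x t.+1) <= n%:R * d by rewrite -sum_cst; exact: ler_sum.
have mux : dotp (- mu t.+1) (x t.+1) <= kappa * norm1 (x t.+1).
  apply: dotp_le_norm1 => i; rewrite mxE -ler_norml normrN ler_norml.
  exact: mu_box.
have := ler_wpM2l (ltW kappa_gt0) x1.
have := ler_wpM2l (ltW lambda_gt0) x2.
have := sqr_ge0 (norm2 (y - A *m x t.+1)).
by move: mux; rewrite dotpNl /obj_g (norm2_sqr (x t.+1)); lra.
Qed.

End Iterates.

(** * Convergence *)

Section Convergence.
Variables (R : realType) (m n : nat) (A : 'M[R]_(m, n)) (y : 'cV[R]_m).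
Variables (lambda d alpha delta : R) (x z mu : nat -> 'cV[R]_n).
Hypotheses (d_gt0 : 0 < d) (lambda_gt0 : 0 < lambda) (alpha_gt0 : 0 < alpha).
Hypothesis xzmu : is_MADMM A y lambda d alpha x z mu.
Hypothesis delta01 : 0 < delta <= 1.
Local Notation Q := (hessian_g A lambda).
Local Notation kappa := (lambda * d).
Hypothesis hess_bnd : forall u : 'cV[R]_n,
  delta * dotp u u <= dotp u (hess (alpha^-1 *: Q) u) <= 5 / 2 * dotp u u.
Hypothesis hess2_bnd : forall u : 'cV[R]_n, delta * dotp u u
  <= 5 * dotp u (hess (alpha^-1 *: Q) u)
     - 2 * dotp (hess (alpha^-1 *: Q) u) (hess (alpha^-1 *: Q) u).

Let delta_gt0 : 0 < delta. Proof. by case/andP: delta01. Qed.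

Lemma step_cvg0 : norm2 (x t.+2 - z t.+1) @[t --> \oo] --> (0 : R).
Proof.
have hess_ge0 (u : 'cV[R]_n) : 0 <= dotp u (hess (alpha^-1 *: Q) u).
  have /andP[h _] := hess_bnd u.
  by apply: le_trans h; rewrite mulr_ge0 ?dotp_ge0 // ltW.
have [M E_lb] := scaled_energy_lb d_gt0 lambda_gt0 alpha_gt0 xzmu hess_ge0.
rewrite -(sqrtr0 R); apply: (@continuous_cvg _ _ _ _ _ _ Num.sqrt).
  exact: sqrt_continuous.
apply: (dissipated_cvg0 (E := scaled_energy A y lambda d alpha x z mu)
  (c := delta / 240) (M := M)) => // [|t|t].
- by rewrite divr_gt0.
- exact: dotp_ge0.
apply: le_trans (scaled_energy_decrease d_gt0 lambda_gt0 alpha_gt0 xzmu t) _.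
by rewrite lerD2l lerN2; exact: dissipation_lb.
Qed.

(** x - z and the increment of z have nonnegative inner product, so each is
    bounded by their sum. *)
Lemma norm1_parts t : norm1 (x t.+1 - z t.+1) <= n%:R * norm2 (x t.+1 - z t) /\
  norm1 (z t.+1 - z t) <= n%:R * norm2 (x t.+1 - z t).
Proof.
have n2 u v : 0 <= dotp u v -> norm2 u <= norm2 (u + v :> 'cV[R]_n).
  move=> uv; rewrite ler_wsqrtr // !dotpE (dotpC v u).
  by have := dotp_ge0 v; lra.
have aD : 0 <= dotp (x t.+1 - z t.+1) (z t.+1 - z t).
  by apply: sumr_ge0 => i _; exact: (gap_sign d_gt0 lambda_gt0 alpha_gt0 xzmu).
have pE : x t.+1 - z t = (x t.+1 - z t.+1) + (z t.+1 - z t).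
  by rewrite addrA subrK.
split; apply: le_trans (norm1_le_norm2 _) _; rewrite ler_wpM2l // pE.
  exact: n2.
by rewrite [X in _ <= norm2 X]addrC n2 // dotpC.
Qed.

(** The residuals of (x, mu) are bounded by x - z and the increment of z: the
    first because mu is an exact subgradient at z, the others because the
    optimality condition in x holds at mu shifted by the increment of z. *)
Lemma residual_bound f : kkt_residuals A y lambda d f ->
  exists2 K, 0 <= K & forall t, f (x t.+1, mu t.+1) <= K * norm2 (x t.+1 - z t).
Proof.
have k0 : 0 <= kappa by rewrite ltW // mulr_gt0.
case=> [->|[u bu <-]].
  exists (2 * kappa * n%:R) => [|t]; first by rewrite mulr_ge0 // mulr_ge0.
  rewrite /dual_slack /=; have [a_le _] := norm1_parts t.
  have := norm1D (z t.+1) (x t.+1 - z t.+1); rewrite addrC subrK.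
  move=> /(ler_wpM2l k0); have := ler_wpM2l k0 a_le.
  have := dotp_mu_z d_gt0 lambda_gt0 alpha_gt0 xzmu t.+1.
  have := dotp_le_norm1 (- (x t.+1 - z t.+1))
    (mu_box d_gt0 lambda_gt0 alpha_gt0 xzmu t.+1).
  by rewrite norm1N dotpNr dotpDr dotpNr; lra.
exists (alpha * (2 * d) * n%:R) => [|t]; first by rewrite !mulr_ge0 // ltW.
have [_ D_le] := norm1_parts t.
have -> : variational_gap A y lambda u (x t.+1, mu t.+1)
    = alpha * dotp (box_mult A y lambda alpha x z mu t) (u - x t.+1)
      + alpha * dotp (u - x t.+1) (z t.+1 - z t).
  rewrite /variational_gap /=.
  have -> : Q *m x t.+1 + lin_g A y + mu t.+1
      = - (alpha *: (box_mult A y lambda alpha x z mu t + (z t.+1 - z t))).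
    have := stationarity_in_x alpha_gt0 xzmu t.
    rewrite -scalemxAl.
    move: (box_mult _ _ _ _ _ _ _ t) (Q *m x t.+1) (lin_g A y).
    move: (mu t.+1) (z t.+1) (z t) => m1 z1 z0 v q l E.
    apply/matrixP => i j; have := congr1 (fun M : 'cV[R]_n => alpha * M i j) E.
    rewrite !mxE mulr0 !mulrDr !mulrA mulfV ?gt_eqF // !mul1r; lra.
  move: (box_mult _ _ _ _ _ _ _ t) (z t.+1 - z t) => v D.
  by rewrite -(opprB (x t.+1) u) !dotpNl !dotpNr dotpZl dotpDl (dotpC D); ring.
have fn := box_mult_normal alpha_gt0 xzmu t bu.
have ux : box (2 * d) (u - x t.+1).
  move=> i; have := x_box xzmu t i; have := bu i; rewrite !mxE.
  by move=> /andP[? ?] /andP[? ?]; apply/andP; split; lra.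
have := dotp_le_norm1 (z t.+1 - z t) ux.
move: (dotp _ _) (dotp _ _) fn => vu uD fn uD_le.
apply: (@le_trans _ _ (alpha * (2 * d * norm1 (z t.+1 - z t)))).
  by rewrite -mulrDr ler_wpM2l ?(ltW alpha_gt0) //; lra.
by rewrite -!mulrA !ler_wpM2l // ltW.
Qed.

End Convergence.

Theorem theorem5 (R : realType) (m n : nat) (A : 'M[R]_(m, n)) (y : 'cV[R]_m)
    (d lambda alpha C gamma : R) (x z mu : nat -> 'cV[R]_n)
    (d_gt0 : 0 < d) (lambda_gt0 : 0 < lambda) (alpha_gt0 : 0 < alpha)
    (C_gt0 : 0 < C) (gamma_gt0 : 0 < gamma)
    (C_lip : lipschitz2 C (grad (obj_g A y lambda)))
    (gamma_sc : forall w v : 'cV[R]_n, strongly_convex gamma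
                  (fun u => aug_lagrangian A y lambda d alpha u w v))
    (alpha_gamma : 2 * C ^+ 2 < alpha * gamma) (alpha_C : C <= alpha)
    (xzmu : is_MADMM A y lambda d alpha x z mu) :
  exists p : nat -> 'cV[R]_n,
    (forall t : nat, (0 < t)%N ->
       is_argmin (stationary A y lambda d) (fun q => norm2 (x t - q)) (p t)) /\
    norm2 (x t - p t) @[t --> \oo] --> (0 : R).
Proof.
have [delta delta01 [hess_bnd hess2_bnd]] :=
  scaled_hess_bounds C_gt0 alpha_gt0 C_lip gamma_sc alpha_gamma alpha_C.
have p0 := step_cvg0 d_gt0 lambda_gt0 alpha_gt0 xzmu delta01 hess_bnd hess2_bnd.
have kappa0 : 0 <= lambda * d by rewrite ltW // mulr_gt0.
have [Z0 Znear] : stationary A y lambda d !=set0 /\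
    forall e, 0 < e -> \forall t \near \oo,
      exists2 p, stationary A y lambda d p & norm2 (x t.+2 - p) < e.
  (* Indices start at 2, as the energy compares two x-steps. *)
  apply: (kkt_approached kappa0 (q := fun t => (x t.+2, mu t.+2)))
    => [t|t|f e fres e0].
  - exact: (x_box xzmu).
  - exact: (mu_box d_gt0 lambda_gt0 alpha_gt0 xzmu).
  have [K K0 fK] := residual_bound d_gt0 lambda_gt0 alpha_gt0 xzmu fres.
  have K1 : 0 < K + 1 by rewrite ltr_wpDl.
  have eK : 0 < e / (K + 1) by rewrite divr_gt0.
  have := p0; move/cvgr0Pnorm_lt => /(_ _ eK); apply: filterS => t.
  rewrite ger0_norm ?norm2_ge0 // ltr_pdivlMr // => pt.
  apply: le_trans (fK t.+1) _; apply: le_trans (ltW pt).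
  by rewrite mulrC ler_wpM2l ?norm2_ge0 // lerDl.
have [p pP] := choice (fun t => stationary_nearest kappa0 (x t) Z0).
exists p; split=> [t _|]; first exact: pP.
apply/cvgr0Pnorm_lt => e e0.
have [N _ NP] := Znear e e0.
exists N.+2 => // -[|[|t]] //= Nt; rewrite ger0_norm ?norm2_ge0 //.
have [p' p'Z] := NP t Nt; apply: le_lt_trans.
by have [_] := pP t.+2; apply.
Qed.
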